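(* For every $C>0$ there is a constant $C''>0$ depending only on $C$ such that for every positive integer $n$, every $C$-dense $n$-element point set $P$ in the plane admits a stacking order $f$ of $\mathcal{D}(P)$ with $$\mathrm{vis}(\mathcal{D}(P),f)\ge C'' n^{2/3}.$$
   Context: For a point $p$ in the plane, $D(p)$ denotes the closed disk of radius $1$ centered at $p$, and for a finite point set $P$, $\mathcal{D}(P)=\{D(p): p\in P\}$. A stacking order of a finite collection $\mathcal{D}$ of $n$ distinct unit disks is a bijection $f:\mathcal{D}\to\{1,\dots,n\}$; $f(D)$ is regarded as the height of $D$, and the arrangement is viewed from below. A point $x$ on the boundary circle of $D\in\mathcal{D}$ is visible if $x$ does not lie in any disk $D'\in\mathcal{D}$ with $f(D')<f(D)$. The visible perimeter $\mathrm{vis}(\mathcal{D},f)$ is the total length of all visible boundary points, summed over all disks of $\mathcal{D}$. An $n$-element point set $P$ is $C$-dense if $\max\{|pq|: p,q\in P\}\,/\,\min\{|pq|: p,q\in P,\ p\ne q\}\le C n^{1/2}$. *)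

(* Defs.v *)
From HB Require Import structures.
From mathcomp Require Import all_boot all_order all_algebra all_fingroup.
From mathcomp Require Import all_classical all_reals all_analysis.
Set Implicit Arguments. Unset Strict Implicit. Unset Printing Implicit Defensive.
Import Order.TTheory GRing.Theory Num.Theory.
Local Open Scope ring_scope.
Local Open Scope classical_set_scope.

Definition dist2 {R : realType} (x y : R * R) : R :=
  Num.sqrt ((x.1 - y.1) ^+ 2 + (x.2 - y.2) ^+ 2).

Definition circ_pt {R : realType} (p : R * R) (t : R) : R * R :=
  (p.1 + cos t, p.2 + sin t).

Definition in_disk {R : realType} (q x : R * R) : Prop := dist2 q x <= 1.

(* The n-point set P is given as an injective map p : 'I_n -> R*R; the
   stacking order f : {perm 'I_n} assigns heights (f i).+1 in {1..n}. *)
Definition visible_angles {R : realType} {n : nat} (p : 'I_n -> R * R)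
  (f : {perm 'I_n}) (i : 'I_n) : set R :=
  [set t | 0 <= t < 2 * pi /\
     forall j : 'I_n, (f j < f i)%N -> ~ in_disk (p j) (circ_pt (p i) t)].

(* visible perimeter: sum over all disks of the length (Lebesgue measure of
   the set of visible angles, i.e. arc length on a unit circle) *)
Definition vis {R : realType} {n : nat} (p : 'I_n -> R * R) (f : {perm 'I_n})
  : \bar R :=
  (\sum_(i < n) (@lebesgue_measure R) (visible_angles p f i))%E.

(* C-dense: max distance / min distance <= C n^(1/2); written out as
   every distance is at most C sqrt(n) times every distance between distinct points *)
Definition C_dense {R : realType} (C : R) {n : nat} (p : 'I_n -> R * R) : Prop :=
  forall a b c d : 'I_n, c != d ->
    dist2 (p a) (p b) <= C * Num.sqrt (n%:R) * dist2 (p c) (p d).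

(* Main.v *)
(* If [D(y)] is below [D(x)], the boundary point of [D(x)] in direction [u] is
   not covered by [D(y)] as soon as [(x - y) . u >= 0], whatever the scale.  Fix
   a centre [c] and stack the points by increasing distance to [c].  Since
     [2 (x - c) . (x - y) = |x - c|^2 - |y - c|^2 + |x - y|^2],
   [x] has a visible arc of length of order [1 / M] around the direction [x - c]
   unless some [y] satisfies
     [||x - c|^2 - |y - c|^2| + |x - y|^2 < 2 s |x - y|],
   where [s = D / M] and [D] bounds the diameter.  Such a conflict forces
   [|x - y| < 2 s], which by density leaves [O(n / M^2)] points [y] for each
   [x]; and since [|x - c|^2 - |y - c|^2] is affine in [c] with gradient
   [2 (y - x)], only a fraction [O(1 / M)] of the centres of an [M * M] grid of
   mesh [s] produce it.  So the average number of conflicts is [O(n^2 / M^3)],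
   below [n / 2] for [M] of order [n^(1/3)], and for some centre at least
   [n / 2] points are conflict-free.  Put at the bottom, these show arcs of
   total length of order [n / M]. *)

Require Import Defs.
From mathcomp Require Import all_boot all_order all_algebra all_fingroup.
From mathcomp Require Import all_classical all_reals all_analysis.
From mathcomp Require Import ring lra zify.

Set Implicit Arguments.
Unset Strict Implicit.
Unset Printing Implicit Defensive.

Import Order.TTheory GRing.Theory Num.Theory.
Import numFieldNormedType.Exports.
Local Open Scope ring_scope.

Section PlaneVectors.
Variable R : realType.
Implicit Types (u v x y z : R * R) (s t : R).

Definition dot u v : R := u.1 * v.1 + u.2 * v.2.
Definition norm2 u : R := Num.sqrt (u.1 ^+ 2 + u.2 ^+ 2).
Definition direction t : R * R := (cos t, sin t).

Lemma dist2E x y : dist2 x y = norm2 (x - y).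
Proof. by []. Qed.

Lemma norm2_ge0 u : 0 <= norm2 u.
Proof. exact: sqrtr_ge0. Qed.

Lemma dotC u v : dot u v = dot v u.
Proof. by rewrite /dot !(mulrC (fst u)) (mulrC (snd u)). Qed.

Lemma sqr_norm2 u : norm2 u ^+ 2 = dot u u.
Proof. by rewrite sqr_sqrtr ?addr_ge0 ?sqr_ge0 // /dot !expr2. Qed.

Lemma norm2_gt0 u : (0 < norm2 u) = (u != 0).
Proof.
rewrite sqrtr_gt0 lt_def addr_ge0 ?sqr_ge0 // andbT paddr_eq0 ?sqr_ge0 //.
by rewrite !sqrf_eq0; case: u.
Qed.

Lemma normr_dot_le u v : `|dot u v| <= norm2 u * norm2 v.
Proof.
rewrite -ler_sqr ?nnegrE ?mulr_ge0 ?norm2_ge0 // real_normK ?num_real //.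
rewrite exprMn !sqr_norm2 /dot -subr_ge0.
suff -> : (u.1 * u.1 + u.2 * u.2) * (v.1 * v.1 + v.2 * v.2) -
    (u.1 * v.1 + u.2 * v.2) ^+ 2 = (u.1 * v.2 - u.2 * v.1) ^+ 2.
  exact: sqr_ge0.
by ring.
Qed.

Lemma norm2D u v : norm2 (u + v) <= norm2 u + norm2 v.
Proof.
rewrite -ler_sqr ?nnegrE ?addr_ge0 ?norm2_ge0 // sqrrD !sqr_norm2.
suff -> : dot (u + v) (u + v) = dot u u + dot u v *+ 2 + dot v v.
  by rewrite lerD2r lerD2l lerMn2r (le_trans (ler_norm _)) ?normr_dot_le.
by rewrite /dot /=; ring.
Qed.

Lemma dist2_triangle z x y : dist2 x y <= dist2 x z + dist2 z y.
Proof. by rewrite !dist2E -[x - y](subrKA z) norm2D. Qed.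

Lemma dist2_ge0 x y : 0 <= dist2 x y.
Proof. by rewrite dist2E norm2_ge0. Qed.

Lemma dist2C x y : dist2 x y = dist2 y x.
Proof. by rewrite /dist2 -(sqrrN (x.1 - _)) -(sqrrN (x.2 - _)) !opprB. Qed.

Lemma dist2_gt0 x y : (0 < dist2 x y) = (x != y).
Proof. by rewrite dist2E norm2_gt0 subr_eq0. Qed.

Lemma dist2xx x : dist2 x x = 0.
Proof. by apply/le_anti; rewrite dist2_ge0 leNgt dist2_gt0 eqxx. Qed.

Lemma normrB1_le_dist2 x y : `|x.1 - y.1| <= dist2 x y.
Proof. by rewrite -sqrtr_sqr ler_wsqrtr // lerDl sqr_ge0. Qed.

Lemma normrB2_le_dist2 x y : `|x.2 - y.2| <= dist2 x y.
Proof. by rewrite -sqrtr_sqr ler_wsqrtr // lerDr sqr_ge0. Qed.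

Lemma dist2_le_normrD x y : dist2 x y <= `|x.1 - y.1| + `|x.2 - y.2|.
Proof.
rewrite -ler_sqr ?nnegrE ?dist2_ge0 ?addr_ge0 // dist2E sqr_norm2 sqrrD /dot.
by rewrite -!expr2 !real_normK ?num_real // lerD2r lerDl mulrn_wge0 ?mulr_ge0.
Qed.

Lemma dot_polarization c x y :
  2 * dot (x - c) (x - y) = dist2 x c ^+ 2 - dist2 y c ^+ 2 + dist2 x y ^+ 2.
Proof. by rewrite !dist2E !sqr_norm2 /dot /=; ring. Qed.

Lemma unit_vector_direction u : norm2 u = 1 ->
  exists2 t, 0 <= t < 2 * pi & u = direction t.
Proof.
case: u => a b norm_ab; have ab1 : a ^+ 2 + b ^+ 2 = 1.
  by have := sqr_norm2 (a, b); rewrite norm_ab /dot /= -!expr2 expr1n.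
have a_itv : -1 <= a <= 1 by apply/andP; split; have := sqr_ge0 b; nra.
have sqrt_b : Num.sqrt (1 - a ^+ 2) = `|b|.
  by rewrite -ab1 addrAC subrr add0r sqrtr_sqr.
have cos_a : cos (acos a) = a by rewrite acosK // in_itv.
have pi0 := pi_gt0 R; have [b0|b0] := leP 0 b.
  exists (acos a).
    by have := acos_ge0 a_itv; have := acos_lepi a_itv; lra.
  by rewrite /direction cos_a sin_acos // sqrt_b ger0_norm.
exists (- acos a + pi *+ 2).
  have a_itv_lt : -1 <= a < 1 by nra.
  have := acos_gt0 a_itv_lt; have := acos_lepi a_itv.
  by rewrite -mulr_natl; lra.
rewrite /direction cosD2pi cosN sinD2pi sinN cos_a sin_acos // sqrt_b.
by rewrite ltr0_norm // opprK.
Qed.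

Lemma dot_norm2_direction u :
  exists2 t, 0 <= t < 2 * pi &
    forall v, dot u v = norm2 u * dot (direction t) v.
Proof.
have [->|u0] := eqVneq u 0.
  exists 0 => [|v]; first by have := pi_gt0 R; lra.
  have -> : norm2 (0 : R * R) = 0 by rewrite /norm2 /= expr0n addr0 sqrtr0.
  by rewrite /dot /=; ring.
have u_gt0 : 0 < norm2 u by rewrite norm2_gt0.
have [|t t_itv ut] := @unit_vector_direction (u.1 / norm2 u, u.2 / norm2 u).
  rewrite /norm2 /= !expr_div_n -mulrDl sqr_norm2 /dot -!expr2 divff ?sqrtr1 //.
  by rewrite !expr2 -/(dot u u) -sqr_norm2 expf_neq0 // gt_eqF.
by exists t => // v; rewrite -ut /dot /=; field; rewrite gt_eqF.
Qed.

End PlaneVectors.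

Lemma lipschitz_of_bounded_derive (R : realType) (f df : R -> R) (k : R) :
  (forall t : R, is_derive t 1 f (df t)) -> (forall t, `|df t| <= k) ->
  forall s t, `|f s - f t| <= k * `|s - t|.
Proof.
move=> fd df_le.
have lip_lt s t : s < t -> `|f t - f s| <= k * `|t - s|.
  move=> st; have f_cont : {within `[s, t], continuous f}%classic.
    apply: continuous_subspaceT => x; apply: differentiable_continuous.
    by apply/derivable1_diffP; case: (fd x).
  have [c _ ->] := MVT st (fun x _ => fd x) f_cont.
  by rewrite normrM ler_wpM2r.
move=> s t; have [|ts|->] := ltgtP s t.
- by move/lip_lt; rewrite distrC (distrC s).
- exact: lip_lt.
- by rewrite !subrr normr0 mulr0.
Qed.

Section Visibility.
Variable R : realType.

Lemma dot_direction_lipschitz (u : R * R) (s t : R) :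
  `|dot u (direction s) - dot u (direction t)| <= norm2 u * `|s - t|.
Proof.
apply: (@lipschitz_of_bounded_derive R (fun t => dot u (direction t))
  (fun t => dot u (- sin t, cos t))) => x.
rewrite (le_trans (normr_dot_le _ _)) // [X in _ * X](_ : _ = 1) ?mulr1 //.
by rewrite /norm2 /= sqrrN addrC cos2Dsin2 sqrtr1.
Qed.

Lemma lebesgue_measure_le (A B : set R) : (A `<=` B)%classic ->
  (lebesgue_measure A <= lebesgue_measure B)%E.
Proof.
move=> AB; rewrite /lebesgue_measure /lebesgue_stieltjes_measure.
by rewrite /measure_extension le_mu_ext.
Qed.

Lemma circ_pt_notin_disk (x y : R * R) (t : R) : x != y ->
  0 <= dot (x - y) (direction t) -> ~ in_disk y (circ_pt x t).
Proof.
rewrite -dist2_gt0 => /(exprn_gt0 2) xy dot0; apply/negP; rewrite -ltNge.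
rewrite -ltr_sqr ?nnegrE ?dist2_ge0 // expr1n.
suff -> : dist2 y (circ_pt x t) ^+ 2 =
    dist2 x y ^+ 2 + 2 * dot (x - y) (direction t) + 1 by lra.
by rewrite !dist2E !sqr_norm2 -[X in _ = _ + X](cos2Dsin2 t) /dot /=; ring.
Qed.

Lemma lebesgue_measure_visible_angles_ge (n : nat) (p : 'I_n -> R * R)
    (f : {perm 'I_n}) (i : 'I_n) (t e : R) :
  injective p -> 0 <= t < 2 * pi -> 0 < e < pi ->
  (forall j, (f j < f i)%N ->
    e * dist2 (p i) (p j) <= dot (p i - p j) (direction t)) ->
  (e%:E <= lebesgue_measure (visible_angles p f i))%E.
Proof.
move=> p_inj t_itv e_itv lower.
have near_visible s :
    0 <= s < 2 * pi -> `|s - t| <= e -> visible_angles p f i s.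
  move=> s_itv st; split=> // j fji; apply: circ_pt_notin_disk.
    by rewrite inj_eq //; apply: contraTneq fji => ->; rewrite ltnn.
  have := dot_direction_lipschitz (p i - p j) s t; rewrite -dist2E.
  move=> /le_trans/(_ (ler_wpM2l (dist2_ge0 _ _) st)); rewrite ler_norml.
  by have := lower j fji; lra.
(* The half of [[t - e, t + e]] on the side of [pi] stays in [[0, 2 pi)]. *)
pose a := if t <= pi then t else t - e.
have -> : e%:E = lebesgue_measure [set` `[a, a + e]].
  rewrite lebesgue_measure_itv /= lte_fin ltrDl; case/andP: e_itv => -> _.
  by rewrite -EFinB addrAC subrr add0r.
apply: lebesgue_measure_le => s /=; rewrite in_itv /= /a => s_itv.
apply: near_visible; last rewrite ler_norml.
  by move: s_itv; case: (leP t pi) => ?; lra.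
by move: s_itv; case: (leP t pi) => ?; lra.
Qed.

End Visibility.

Lemma exists_perm_sorting (n : nat) (leT : rel 'I_n) :
  total leT -> transitive leT ->
  exists f : {perm 'I_n}, forall i j, (f j < f i)%N -> leT j i.
Proof.
move=> leT_total leT_trans; pose s := sort leT (enum 'I_n).
have mem_s i : i \in s by rewrite mem_sort mem_enum.
have index_lt i : (index i s < n)%N.
  by rewrite -[ltnRHS](size_enum_ord n) -(size_sort leT) index_mem.
have index_s_inj : injective (fun i => Ordinal (index_lt i)).
  by move=> i j [/index_inj]; apply.
exists (perm index_s_inj) => i j; rewrite !permE /=.
exact: sorted_ltn_index (sort_sorted leT_total _) _ _ _ _.
Qed.

Lemma exists_le_average (R : realDomainType) (T : finType) (F : T -> R)
    (B : R) :
  (0 < #|T|)%N -> \sum_t F t <= #|T|%:R * B -> exists t, F t <= B.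
Proof.
move=> /card_gt0P[t0 _] sumF; apply/existsP.
apply: contraLR sumF => /existsPn F_gt; rewrite -ltNge mulr_natl -sumr_const.
apply: ltr_sum => [|t _]; last by rewrite ltNge F_gt.
by apply/hasP; exists t0; rewrite ?mem_index_enum.
Qed.

Lemma exchange_card (S T : finType) (r : S -> T -> bool) :
  (\sum_s #|[pred t | r s t]| = \sum_t #|[pred s | r s t]|)%N.
Proof.
under eq_bigr do rewrite -sum1_card big_mkcond.
under [RHS]eq_bigr do rewrite -sum1_card big_mkcond.
exact: exchange_big.
Qed.

Lemma card_pred_pair (S T : finType) (r : S -> T -> bool) :
  (#|[pred c | r c.1 c.2]| = \sum_s #|[pred t | r s t]|)%N.
Proof.
under eq_bigr do rewrite -sum1_card.
by rewrite pair_big_dep /= -sum1_card.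
Qed.

Section GridCounting.
Variable R : realFieldType.

Lemma card_progression_near (M w : nat) (a x : R) :
  (#|[pred k : 'I_M | (`|a - k%:R * x| < w%:R * `|x|)%R]| <= 2 * w)%N.
Proof.
set A := [pred k : 'I_M | _].
have [wx_le0|wx_gt0] := leP (w%:R * `|x|) 0.
  rewrite eq_card0 // => k; apply/negbTE; rewrite inE -leNgt.
  exact: le_trans wx_le0 _.
have w_gt0 : (0 < 2 * w)%N.
  by rewrite muln_gt0 /=; case: w wx_gt0 {A} => //; rewrite mul0r ltxx.
have x_gt0 : 0 < `|x| by move: wx_gt0; rewrite pmulr_rgt0 // ltr0n; lia.
pose residue (k : 'I_M) := Ordinal (ltn_pmod k w_gt0).
have near k l : k \in A -> l \in A -> (k < l + 2 * w)%N.
  rewrite !inE => ka la; rewrite -(ltr_nat R) natrD natrM -ltrBlDl.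
  rewrite -(ltr_pM2r x_gt0) (le_lt_trans (ler_norm _)) // normrM normr_id.
  rewrite -normrM (_ : _ * x = (a - l%:R * x) - (a - k%:R * x)); last by ring.
  by rewrite (le_lt_trans (ler_normB _ _)) //; lra.
rewrite -[leqRHS]card_ord -(card_in_imset (f := residue)) ?max_card //.
move=> k l kA lA [/eqP kl]; wlog lk : k l kA lA kl / (l <= k)%N => [ordered|].
  have [|/ltnW kl_le] := leqP l k; first exact: ordered.
  by apply/esym/ordered; rewrite // eq_sym.
apply/eqP; move: kl; rewrite eqn_mod_dvd //; apply: contraTT => neq_kl.
have := near k l kA lA; rewrite -val_eqE /= in neq_kl *.
by move=> k_lt; rewrite gtnNdvd //; lia.
Qed.

Lemma card_grid_near_line (M : nat) (a x y d : R) : d <= `|x| + `|y| ->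
  (#|[pred c : 'I_M * 'I_M | (`|a - (c.1%:R * x + c.2%:R * y)| < d)%R]|
    <= 4 * M)%N.
Proof.
have card_line b z : d <= 2 * `|z| ->
    (#|[pred k : 'I_M | (`|b - k%:R * z| < d)%R]| <= 4)%N.
  move=> dz; apply: leq_trans (card_progression_near M 2 b z).
  apply/subset_leq_card/fintype.subsetP => k.
  by rewrite !inE => /lt_le_trans; apply.
have sum4 : (4 * M = \sum_(k < M) 4)%N by rewrite sum_nat_const card_ord mulnC.
move=> dxy; rewrite sum4.
rewrite (card_pred_pair (fun k l : 'I_M => `|a - (k%:R * x + l%:R * y)| < d)).
have [yx|/ltW xy] := leP `|y| `|x|.
  rewrite exchange_card; apply: leq_sum => l _.
  apply: leq_trans (card_line (a - l%:R * y) x _); last by lra.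
  by apply/eq_leq/eq_card => k; rewrite !inE opprD addrA addrAC.
apply: leq_sum => k _.
apply: leq_trans (card_line (a - k%:R * x) y _); last by lra.
by apply/eq_leq/eq_card => l; rewrite !inE opprD addrA.
Qed.

End GridCounting.

Lemma exists_interval_cells (R : archiRealFieldType) (r h : R) :
  0 <= r -> 0 < h ->
  exists m, exists2 cell : R -> 'I_m, m%:R * h <= 2 * r + h &
    forall z w, `|z| < r -> `|w| < r -> cell z = cell w -> `|z - w| < h.
Proof.
move=> r0 h0; pose slot z := Num.truncn ((z + r) / h).
exists (Num.truncn (2 * r / h)).+1, (fun z => inord (slot z)).
  have : (Num.truncn (2 * r / h))%:R <= 2 * r / h.
    by rewrite truncn_le divr_ge0 ?mulr_ge0 // ltW.
  by rewrite ler_pdivlMr // -natr1; lra.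
have slot_le z : `|z| < r -> (slot z <= Num.truncn (2 * r / h))%N.
  rewrite ltr_norml => z_itv; rewrite le_truncn // ler_pM2r ?invr_gt0 //.
  by lra.
have slot_itv z : `|z| < r -> (slot z)%:R <= (z + r) / h < (slot z)%:R + 1.
  rewrite natr1 ltr_norml => z_itv; apply: truncn_itv.
  by rewrite divr_ge0 ?(ltW h0) //; lra.
move=> z w zr wr /(congr1 val); rewrite /= !inordK ?ltnS ?slot_le // => zw.
have : `|(z + r) / h - (w + r) / h| < 1.
  by have := slot_itv z zr; have := slot_itv w wr; rewrite zw ltr_norml; lra.
rewrite -mulrBl normrM normfV (gtr0_norm h0) ltr_pdivrMr // mul1r.
by rewrite opprD addrACA subrr addr0.
Qed.

Section Separated.
Variables (R : realType) (T : finType).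
Implicit Types (p : T -> R * R) (del r : R).

Definition separated del p := forall a b, a != b -> del <= dist2 (p a) (p b).

Lemma separated_inj del p : 0 < del -> separated del p -> injective p.
Proof.
move=> del0 sep a b pab; apply/eqP; apply: contraTT del0 => /sep.
by rewrite pab dist2xx -leNgt.
Qed.

Lemma card_separated_disk del p r (o : R * R) (A : {pred T}) :
  0 < del -> 0 <= r -> separated del p -> {in A, forall a, dist2 (p a) o < r} ->
  #|A|%:R * del ^+ 2 <= (4 * r + del) ^+ 2.
Proof.
move=> del0 r0 sep A_disk; have h0 : 0 < del / 2 by rewrite divr_gt0.
have [m [cell m_le cell_near]] := exists_interval_cells r0 h0.
pose square a := (cell (p a - o).1, cell (p a - o).2).
have square_inj : {in A &, injective square}.
  move=> a b /A_disk ao /A_disk bo [].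
  move=> /(cell_near _ _ (le_lt_trans (normrB1_le_dist2 _ _) ao)
                         (le_lt_trans (normrB1_le_dist2 _ _) bo)) near1.
  move=> /(cell_near _ _ (le_lt_trans (normrB2_le_dist2 _ _) ao)
                         (le_lt_trans (normrB2_le_dist2 _ _) bo)) near2.
  have := dist2_le_normrD (p a) (p b); move: near1 near2.
  rewrite !opprB !addrA !subrK => near1 near2 p_near.
  by apply/eqP; apply: contraT => /sep; lra.
have card_A : (#|A| <= m * m)%N.
  rewrite -(card_in_imset square_inj) (leq_trans (max_card _)) //.
  by rewrite card_prod card_ord.
apply: (@le_trans _ _ ((m%:R * del) ^+ 2)).
  by rewrite exprMn ler_wpM2r ?sqr_ge0 // -natrX ler_nat.
have : 0 <= m%:R * del by rewrite mulr_ge0 // ltW.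
by move=> m_del_ge0; rewrite lerXn2r ?nnegrE //; lra.
Qed.

Lemma card_close_pairs del p r : 0 < del -> 0 <= r -> separated del p ->
  #|[pred ab | (ab.1 != ab.2) && (dist2 (p ab.1) (p ab.2) < r)]|%:R * del ^+ 2
    <= #|T|%:R * (25 * r ^+ 2).
Proof.
move=> del0 r0 sep.
rewrite (card_pred_pair (fun a b => (a != b) && (dist2 (p a) (p b) < r))).
rewrite natr_sum mulr_suml mulr_natl -sumr_const; apply: ler_sum => a _.
set A := [pred b | _]; have [b /andP[ab abr]|A0] := pickP A; last first.
  by rewrite (eq_card0 A0) mul0r mulr_ge0 ?sqr_ge0.
have del_r : del < r := le_lt_trans (sep a b ab) abr.
apply: le_trans (card_separated_disk (o := p a) (A := A) del0 r0 sep _) _.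
  by move=> c; rewrite inE dist2C => /andP[].
by nra.
Qed.

End Separated.

Section Conflicts.
Variable R : realType.
Implicit Types (s del : R) (c o x y : R * R).

(* By [dot_polarization], when [x] is farther from [c] than [y], a conflict
   means that [dot (x - c) (x - y) < s * dist2 x y]: [y] almost reaches the
   tangent at [x] to the circle around [c]. *)
Definition conflict s c x y : bool :=
  (x != y) &&
  (`|dist2 x c ^+ 2 - dist2 y c ^+ 2| + dist2 x y ^+ 2 < 2 * s * dist2 x y).

Lemma conflict_dist2_lt s c x y : conflict s c x y -> dist2 x y < 2 * s.
Proof.
rewrite /conflict -dist2_gt0 => /andP[xy]; rewrite expr2 => conf.
by rewrite -(ltr_pM2r xy) (le_lt_trans _ conf) // lerDr.
Qed.

Lemma dot_ge_of_no_conflict s c x y :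
  x != y -> ~~ conflict s c x y -> dist2 y c <= dist2 x c ->
  s * dist2 x y <= dot (x - c) (x - y).
Proof.
move=> xy; rewrite /conflict xy -leNgt => no_conf yx.
rewrite -(ler_pM2l (ltr0n R 2)) dot_polarization mulrA.
rewrite (le_trans no_conf) // ger0_norm // subr_ge0.
by rewrite lerXn2r ?nnegrE ?dist2_ge0.
Qed.

Definition grid_point (M : nat) s o (k : 'I_M * 'I_M) : R * R :=
  (o.1 + k.1%:R * s, o.2 + k.2%:R * s).

Lemma dist2_grid_point_le (M : nat) s o (k : 'I_M * 'I_M) : 0 <= s ->
  dist2 o (grid_point s o k) <= 2 * (M%:R * s).
Proof.
move=> s0; have ord_le (m : 'I_M) : `|m%:R * s| <= M%:R * s.
  by rewrite ger0_norm ?mulr_ge0 // ler_wpM2r // ler_nat ltnW.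
rewrite (le_trans (dist2_le_normrD _ _)) // /= !opprD !addNKr !normrN.
by have := ord_le k.1; have := ord_le k.2; lra.
Qed.

Lemma card_conflict_grid (M : nat) s o x y : 0 < s ->
  (#|[pred k : 'I_M * 'I_M | conflict s (grid_point s o k) x y]| <= 4 * M)%N.
Proof.
move=> s0; pose a := (dist2 x o ^+ 2 - dist2 y o ^+ 2) / (2 * s).
apply: leq_trans (card_grid_near_line M a (dist2_le_normrD x y)).
apply/subset_leq_card/fintype.subsetP => k; rewrite !inE => /andP[_ conf].
have s2_gt0 : 0 < 2 * s by rewrite mulr_gt0.
rewrite -(ltr_pM2l s2_gt0) -[X in X * `|_|]gtr0_norm // -normrM.
rewrite (_ : 2 * s * _ =
    dist2 x (grid_point s o k) ^+ 2 - dist2 y (grid_point s o k) ^+ 2).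
  by rewrite (le_lt_trans _ conf) // lerDl sqr_ge0.
by rewrite /a !dist2E !sqr_norm2 /dot /=; field; rewrite gt_eqF.
Qed.

Section Configuration.
Variables (T : finType) (p : T -> R * R).

Definition conflict_pairs s c : {pred T * T} :=
  [pred ab | conflict s c (p ab.1) (p ab.2)].

Definition conflict_free s c : {pred T} :=
  [pred a | [forall b, ~~ conflict s c (p a) (p b)]].

Lemma leq_card_conflict_free s c :
  (#|T| <= #|conflict_free s c| + #|conflict_pairs s c|)%N.
Proof.
rewrite -(cardC (conflict_free s c)) leq_add2l.
have /subset_leq_card/leq_trans -> // : [predC conflict_free s c] \subset
    [set ab.1 | ab in conflict_pairs s c]%SET; last exact: leq_imset_card.
apply/fintype.subsetP => a; rewrite !inE negb_forall => /existsP[b].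
by rewrite negbK => ab; apply/imsetP; exists (a, b).
Qed.

Lemma exists_center_few_conflicts (M : nat) del s o :
  0 < del -> 0 < s -> (0 < M)%N -> separated del p ->
  exists k : 'I_M * 'I_M,
    #|conflict_pairs s (grid_point s o k)|%:R * (M%:R * del ^+ 2)
      <= #|T|%:R * (400 * s ^+ 2).
Proof.
move=> del0 s0 M0 sep.
pose close := [pred ab | (ab.1 != ab.2) && (dist2 (p ab.1) (p ab.2) < 2 * s)].
have card_close : #|close|%:R * del ^+ 2 <= #|T|%:R * (100 * s ^+ 2).
  rewrite (_ : 100 * s ^+ 2 = 25 * (2 * s) ^+ 2); last by ring.
  by apply: card_close_pairs => //; rewrite mulr_ge0 // ltW.
have sum_conflicts :
    (\sum_(k : 'I_M * 'I_M) #|conflict_pairs s (grid_point s o k)|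
      <= #|close| * (4 * M))%N.
  rewrite (exchange_card (fun k ab =>
    conflict s (grid_point s o k) (p ab.1) (p ab.2))).
  rewrite -sum_nat_const [leqRHS]big_mkcond; apply: leq_sum => ab _ /=.
  case: ifPn => [_|not_close]; first exact: card_conflict_grid.
  rewrite eq_card0 // => k; apply/negbTE; apply: contra not_close => conf.
  rewrite inE (conflict_dist2_lt conf) andbT.
  by case/andP: conf => + _; apply: contraNneq => ->.
apply: exists_le_average; first by rewrite card_prod card_ord muln_gt0 M0.
rewrite -mulr_suml -natr_sum card_prod card_ord.
have sqrM_ge0 : 0 <= 4 * (M%:R ^+ 2) :> R by rewrite mulr_ge0 ?sqr_ge0.
apply: (@le_trans _ _ ((#|close| * (4 * M))%:R * (M%:R * del ^+ 2))).
  by rewrite ler_wpM2r ?ler_nat // mulr_ge0 ?sqr_ge0.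
by have := ler_wpM2l sqrM_ge0 card_close; rewrite !natrM; lra.
Qed.

Lemma exists_center_half_conflict_free (M : nat) del s o :
  0 < del -> 0 < s -> (0 < M)%N -> separated del p ->
  800 * s ^+ 2 <= M%:R * del ^+ 2 ->
  exists k : 'I_M * 'I_M,
    #|T|%:R / 2 <= #|conflict_free s (grid_point s o k)|%:R :> R.
Proof.
move=> del0 s0 M0 sep s_le.
have [k few_conflicts] := exists_center_few_conflicts o del0 s0 M0 sep.
exists k; have Mdel0 : 0 < M%:R * del ^+ 2.
  by rewrite mulr_gt0 ?exprn_gt0 ?ltr0n.
have conflicts_le :
    #|conflict_pairs s (grid_point s o k)|%:R <= #|T|%:R / 2 :> R.
  by rewrite -(ler_pM2r Mdel0); have := ler_wpM2l (ler0n R #|T|) s_le; lra.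
have := leq_card_conflict_free s (grid_point s o k).
by rewrite -(ler_nat R) natrD; lra.
Qed.

End Configuration.
End Conflicts.

Section Stacking.
Variables (R : realType) (n : nat) (p : 'I_n -> R * R).

Lemma exists_stacking_conflict_free_first (s : R) (c : R * R) :
  exists f : {perm 'I_n}, forall i j, i \in conflict_free p s c ->
    (f j < f i)%N -> dist2 (p j) c <= dist2 (p i) c.
Proof.
pose below j i := (i \in conflict_free p s c) ==>
  (j \in conflict_free p s c) && (dist2 (p j) c <= dist2 (p i) c).
have below_total : total below.
  move=> i j; rewrite /below; case: (i \in _); case: (j \in _) => //=.
  exact: le_total.
have below_trans : transitive below.
  move=> j i k ij jk; apply/implyP => /(implyP jk)/andP[j_free jk_le].
  by have /andP[-> ij_le] := implyP ij j_free; exact: le_trans jk_le.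
have [f f_sorts] := exists_perm_sorting below_total below_trans.
by exists f => i j i_free /f_sorts; rewrite /below i_free => /andP[].
Qed.

Lemma exists_stacking_vis_ge_conflict_free (s e : R) (c : R * R) :
  injective p -> 0 < s -> 0 < e < pi -> (forall i, dist2 (p i) c * e <= s) ->
  exists f : {perm 'I_n}, ((#|conflict_free p s c|%:R * e)%:E <= vis p f)%E.
Proof.
move=> p_inj s0 e_itv es.
have [f f_below] := exists_stacking_conflict_free_first s c; exists f.
rewrite mulr_natl -sumr_const -sumEFin big_mkcond /=.
apply: lee_sum => i _; case: ifP => // i_free.
have [t t_itv dot_t] := dot_norm2_direction (p i - c).
apply: (lebesgue_measure_visible_angles_ge p_inj t_itv e_itv) => j fji.
have pij : p i != p j.
  by rewrite inj_eq //; apply: contraTneq fji => ->; rewrite ltnn.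
have /forallP/(_ j) no_conf := i_free.
have := dot_ge_of_no_conflict pij no_conf (f_below _ _ i_free fji).
rewrite dot_t -dist2E dotC => dot_ge.
have dist_gt0 : 0 < dist2 (p i) c.
  rewrite lt_def dist2_ge0 andbT; apply: contraTneq dot_ge => ->.
  by rewrite mul0r -ltNge mulr_gt0 ?dist2_gt0.
rewrite -(ler_pM2l dist_gt0) mulrA (le_trans _ dot_ge) //.
by rewrite ler_wpM2r ?dist2_ge0.
Qed.

Lemma exists_stacking_of_separated (del D : R) (M : nat) :
  (0 < n)%N -> (0 < M)%N -> 0 < del -> 0 < D -> separated del p ->
  (forall i j, dist2 (p i) (p j) <= D) ->
  800 * D ^+ 2 <= M%:R ^+ 3 * del ^+ 2 ->
  exists f : {perm 'I_n}, ((n%:R / (6 * M%:R))%:E <= vis p f)%E.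
Proof.
move=> n0 M0 del0 D0 sep diam D_le; have M_gt0 : 0 < M%:R :> R by rewrite ltr0n.
pose s := D / M%:R; pose e : R := (3 * M%:R)^-1; pose o := p (Ordinal n0).
have s0 : 0 < s by rewrite divr_gt0.
have e0 : 0 < e by rewrite invr_gt0 mulr_gt0.
have Ms : M%:R * s = D by rewrite mulrC divfK ?gt_eqF.
have s_le : 800 * s ^+ 2 <= M%:R * del ^+ 2.
  have sqrM_gt0 : 0 < M%:R ^+ 2 :> R by rewrite exprn_gt0.
  by rewrite -(ler_pM2r sqrM_gt0); move: D_le; rewrite -Ms; lra.
have [k half_free] := exists_center_half_conflict_free o del0 s0 M0 sep s_le.
set c := grid_point s o k in half_free; rewrite card_ord in half_free.
have near_c i : dist2 (p i) c * e <= s.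
  have -> : s = 3 * D * e by rewrite /s /e; field; rewrite gt_eqF.
  have := dist2_grid_point_le o k (ltW s0); rewrite Ms -/c => oc.
  rewrite ler_wpM2r ?(ltW e0) //.
  have io : dist2 (p i) o <= D := diam i _.
  by have := dist2_triangle o (p i) c; lra.
have e_itv : 0 < e < pi.
  have M1 : 1 <= M%:R :> R by rewrite ler1n.
  have e1 : e < 1 by rewrite invf_lt1 ?mulr_gt0 //; lra.
  by have := pi_ge2 R; lra.
have p_inj := separated_inj del0 sep.
have [f f_vis] := exists_stacking_vis_ge_conflict_free p_inj s0 e_itv near_c.
exists f; apply: le_trans f_vis; rewrite lee_fin.
have -> : n%:R / (6 * M%:R) = n%:R / 2 * e by rewrite /e; field; rewrite gt_eqF.
by rewrite ler_wpM2r ?(ltW e0).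
Qed.

End Stacking.

Lemma C_dense_separated (R : realType) (C : R) (n : nat) (p : 'I_n -> R * R) :
  0 < C -> injective p -> C_dense C p ->
  exists del : R, [/\ 0 < del, separated del p &
    forall i j, dist2 (p i) (p j) <= C * Num.sqrt n%:R * del].
Proof.
move=> C0 p_inj dense.
have sqrtn_ge0 : 0 <= C * Num.sqrt n%:R by rewrite mulr_ge0 ?sqrtr_ge0 ?ltW.
have [ab ab_neq|no_neq] := pickP [pred ij : 'I_n * 'I_n | ij.1 != ij.2].
  pose min_pair := [arg min_(ij < ab | ij.1 != ij.2) dist2 (p ij.1) (p ij.2)]%O.
  exists (dist2 (p min_pair.1) (p min_pair.2)); rewrite /min_pair.
  case: arg_minP => // -[c d] /= cd min_cd; split=> [||i j]; last exact: dense.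
    by rewrite dist2_gt0 inj_eq.
  by move=> i j ij; exact: (min_cd (i, j)).
have eq_ord (i j : 'I_n) : i = j by have /negbFE/eqP := no_neq (i, j).
exists 1; split=> // [i j|i j]; first by rewrite (eq_ord i j) eqxx.
by rewrite (eq_ord i j) dist2xx mulr1.
Qed.

Lemma exists_stacking_of_C_dense (R : realType) (C : R) (n : nat)
    (p : 'I_n -> R * R) (M : nat) :
  0 < C -> (0 < n)%N -> (0 < M)%N -> injective p -> C_dense C p ->
  800 * C ^+ 2 * n%:R <= M%:R ^+ 3 ->
  exists f : {perm 'I_n}, ((n%:R / (6 * M%:R))%:E <= vis p f)%E.
Proof.
move=> C0 n0 M0 p_inj dense M_ge.
have [del [del0 sep diam]] := C_dense_separated C0 p_inj dense.
apply: (exists_stacking_of_separated n0 M0 del0 _ sep diam).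
  by rewrite !mulr_gt0 // sqrtr_gt0 ltr0n.
rewrite 2!exprMn sqr_sqrtr // mulrA (mulrA 800).
by rewrite ler_wpM2r ?sqr_ge0.
Qed.

Lemma exists_pos_nat_near (R : archiRealDomainType) (x : R) : 0 <= x ->
  exists M, [/\ (0 < M)%N, x <= M%:R & M%:R <= x + 1].
Proof.
move=> /truncn_itv; rewrite -natr1 => x_itv.
by exists (Num.truncn x).+1; rewrite -natr1; split=> //; lra.
Qed.

Lemma powR_invnX (R : realType) (a : R) (k m : nat) :
  powR a k%:R^-1 ^+ m = powR a (m%:R / k%:R).
Proof. by rewrite -powR_mulrn ?powR_ge0 // -powRrM mulrC. Qed.

Theorem theorem4 (R : realType) (C : R) (hC : 0 < C) :
  exists C'' : R, 0 < C'' /\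
    forall (n : nat) (p : 'I_n -> R * R),
      (0 < n)%N -> injective p -> C_dense C p ->
      exists f : {perm 'I_n},
        ((C'' * powR (n%:R) (2 / 3))%:E <= vis p f)%E.
Proof.
pose K := 1 + 800 * C ^+ 2.
have K1 : 1 <= K by rewrite /K; have := sqr_ge0 C; lra.
exists (6 * (K + 1))^-1; split; first by rewrite invr_gt0; lra.
move=> n p n0 p_inj dense; pose q : R := powR n%:R 3^-1.
have q3 : q ^+ 3 = n%:R by rewrite powR_invnX divff ?pnatr_eq0 ?powRr1.
have q1 : 1 <= q by rewrite -(expr_ge1 (n := 3)) ?powR_ge0 // q3 ler1n.
have Kq0 : 0 <= K * q by rewrite mulr_ge0; lra.
have [M [M0 M_ge M_le]] := exists_pos_nat_near Kq0.
have CM_le : 800 * C ^+ 2 * n%:R <= M%:R ^+ 3.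
  apply: (@le_trans _ _ ((K * q) ^+ 3)); last by rewrite lerXn2r ?nnegrE.
  rewrite exprMn q3 ler_wpM2r // (@le_trans _ _ K) ?ler_eXnr //.
  by rewrite /K; lra.
have [f f_vis] := exists_stacking_of_C_dense hC n0 M0 p_inj dense CM_le.
exists f; apply: le_trans f_vis; rewrite lee_fin -powR_invnX -/q -q3.
rewrite ler_pdivlMr ?mulr_gt0 ?ltr0n // -mulrA ler_pdivrMl; last by lra.
have : M%:R <= (K + 1) * q by lra.
have : 0 <= q ^+ 2 by exact: sqr_ge0.
by move=> q2 /(ler_wpM2l q2); rewrite [q ^+ 3]exprSr; lra.
Qed.
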